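(* Let $\mathbf{P}$ be a small category whose set of objects $P$ has a measure $\mu$, let $\mathbf{A}$ be an abelian category, let $\mathcal{O}$ be a class of objects of $\mathbf{A}$ containing $0$ and closed under isomorphism, and let $\alpha$ be a weight on $\mathcal{O}$. If $\alpha$ is an amplitude on $\mathcal{O}$, then $\mu\circ\alpha$ is an amplitude on $\mathcal{T}_{\mathcal{O},\mu,\alpha}$.
   Context: A weight on a class $\mathcal{O}$ of objects (containing $0$ and closed under isomorphism) of an abelian category is an assignment of $\alpha(A)\in[0,\infty]$ to each $A\in\mathcal{O}$ such that $\alpha(0)=0$ and $\alpha(A)=\alpha(B)$ whenever $A\cong B$. It is an amplitude if for each short exact sequence $0\to A\to B\to C\to0$: if $A,B\in\mathcal{O}$ then $\alpha(A)\le\alpha(B)$; if $B,C\in\mathcal{O}$ then $\alpha(C)\le\alpha(B)$; and if $A,B,C\in\mathcal{O}$ then $\alpha(B)\le\alpha(A)+\alpha(C)$. A persistence module is a functor $M:\mathbf{P}\to\mathbf{A}$; these form the abelian category $\mathbf{A}^{\mathbf{P}}$. $\mathcal{T}_{\mathcal{O},\mu,\alpha}$ is the class of persistence modules $M$ such that $M(p)\in\mathcal{O}$ for all $p\in P$ and the function $\alpha(M):P\to[0,\infty]$, $p\mapsto\alpha(M(p))$, is $\mu$-integrable (measurable with finite integral). For such $M$, $(\mu\circ\alpha)(M)=\int_P\alpha(M)\,d\mu$. *)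

(* Defs.v *)
From HB Require Import structures.
From mathcomp Require Import all_boot all_order all_algebra.
From mathcomp Require Import all_classical all_reals all_analysis.

Set Implicit Arguments.
Unset Strict Implicit.
Unset Printing Implicit Defensive.

Import Order.TTheory GRing.Theory Num.Theory.
Local Open Scope classical_set_scope.
Local Open Scope ring_scope.

Record category (ob : Type) := Category {
  hom : ob -> ob -> Type;
  idm : forall x, hom x x;
  comp : forall x y z, hom y z -> hom x y -> hom x z;
  compA : forall w x y z (h : hom y z) (g : hom x y) (f : hom w x),
    comp h (comp g f) = comp (comp h g) f;
  comp1m : forall x y (f : hom x y), comp (idm y) f = f;
  compm1 : forall x y (f : hom x y), comp f (idm x) = f }.

Arguments idm {ob c} x.
Arguments comp {ob c x y z}.

Reserved Notation "g ∘ f" (at level 40, left associativity).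
Notation "g ∘ f" := (comp g f) : ring_scope.

(* GRing.Zmodule includes a choice structure on each hom; boolp.gen_choiceMixin
   provides one on every type, so this is no restriction. *)
Record homgroup_category (ob : Type) := HomgroupCategory {
  category_of_homgroup :> category ob;
  hom_zmodule : forall x y, GRing.Zmodule (hom category_of_homgroup x y) }.

HB.instance Definition _ (ob : Type) (A : homgroup_category ob) (x y : ob) :=
  hom_zmodule A x y.

Record preadditive (ob : Type) := Preadditive {
  homgroup_of_preadditive :> homgroup_category ob;
  compDl : forall x y z (g g' : hom homgroup_of_preadditive y z)
    (f : hom homgroup_of_preadditive x y), (g + g') ∘ f = g ∘ f + g' ∘ f;
  compDr : forall x y z (g : hom homgroup_of_preadditive y z)
    (f f' : hom homgroup_of_preadditive x y), g ∘ (f + f') = g ∘ f + g ∘ f' }.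

Section CategoryNotions.
Context {ob : Type} (C : category ob).

Definition isomorphic (x y : ob) : Prop :=
  exists (f : hom C x y) (g : hom C y x), g ∘ f = idm x /\ f ∘ g = idm y.

Definition monic x y (f : hom C x y) : Prop :=
  forall w (g h : hom C w x), f ∘ g = f ∘ h -> g = h.

Definition epic x y (f : hom C x y) : Prop :=
  forall z (g h : hom C y z), g ∘ f = h ∘ f -> g = h.

Definition is_zero (z : ob) : Prop :=
  (forall x, exists f : hom C z x, forall g, g = f) /\
  (forall x, exists f : hom C x z, forall g, g = f).

End CategoryNotions.

Section PreadditiveNotions.
Context {ob : Type} (A : preadditive ob).

Definition is_kernel k x y (i : hom A k x) (f : hom A x y) : Prop :=
  f ∘ i = 0 /\
  forall w (g : hom A w x), f ∘ g = 0 -> exists! u : hom A w k, i ∘ u = g.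

Definition is_cokernel x y c (p : hom A y c) (f : hom A x y) : Prop :=
  p ∘ f = 0 /\
  forall w (g : hom A y w), g ∘ f = 0 -> exists! u : hom A c w, u ∘ p = g.

Definition is_biproduct x y b
    (i : hom A x b) (j : hom A y b) (p : hom A b x) (q : hom A b y) : Prop :=
  [/\ p ∘ i = idm x, q ∘ j = idm y, q ∘ i = 0, p ∘ j = 0
    & i ∘ p + j ∘ q = idm b].

(* The image is the kernel of the cokernel. *)
Definition is_image k x y (i : hom A k y) (f : hom A x y) : Prop :=
  exists c (p : hom A y c), is_cokernel p f /\ is_kernel i p.

Definition exact x y z (f : hom A x y) (g : hom A y z) : Prop :=
  exists k (i : hom A k y), is_image i f /\ is_kernel i g.

(* 0 --> x --> y --> z --> 0 is exact. *)
Definition short_exact x y z (f : hom A x y) (g : hom A y z) : Prop :=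
  [/\ monic f, exact f g & epic g].

End PreadditiveNotions.

Record abelian_category (ob : Type) := AbelianCategory {
  preadditive_of_abelian :> preadditive ob;
  ab_zero : exists z, is_zero preadditive_of_abelian z;
  ab_biproduct : forall x y, exists b
    (i : hom preadditive_of_abelian x b) (j : hom preadditive_of_abelian y b)
    (p : hom preadditive_of_abelian b x) (q : hom preadditive_of_abelian b y),
    is_biproduct i j p q;
  ab_kernel : forall x y (f : hom preadditive_of_abelian x y),
    exists k (i : hom preadditive_of_abelian k x), is_kernel i f;
  ab_cokernel : forall x y (f : hom preadditive_of_abelian x y),
    exists c (p : hom preadditive_of_abelian y c), is_cokernel p f;
  ab_monic : forall x y (f : hom preadditive_of_abelian x y),
    monic f ->
    exists z (g : hom preadditive_of_abelian y z), is_kernel f g;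
  ab_epic : forall x y (f : hom preadditive_of_abelian x y),
    epic f ->
    exists w (g : hom preadditive_of_abelian w x), is_cokernel f g }.

Section PreadditiveTheory.
Context {ob : Type} (A : preadditive ob).

Lemma comp0m x y z (f : hom A x y) : (0 : hom A y z) ∘ f = 0.
Proof. by apply: (addrI ((0 : hom A y z) ∘ f)); rewrite -compDl !addr0. Qed.

Lemma compm0 x y z (g : hom A y z) : g ∘ (0 : hom A x y) = 0.
Proof. by apply: (addrI (g ∘ (0 : hom A x y))); rewrite -compDr !addr0. Qed.

Lemma compNm x y z (g : hom A y z) (f : hom A x y) : (- g) ∘ f = - (g ∘ f).
Proof. by apply: (addrI (g ∘ f)); rewrite -compDl !subrr comp0m. Qed.

Lemma compmN x y z (g : hom A y z) (f : hom A x y) : g ∘ (- f) = - (g ∘ f).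
Proof. by apply: (addrI (g ∘ f)); rewrite -compDr !subrr compm0. Qed.

Lemma kernel_monic k x y (i : hom A k x) (f : hom A x y) :
  is_kernel i f -> monic i.
Proof.
move=> [fi0 iP] w g h igh.
have [|u [_ uu]] := iP _ (i ∘ g); first by rewrite compA fi0 comp0m.
by rewrite -(uu g erefl) -(uu h (esym igh)).
Qed.

Lemma cokernel_epic x y c (p : hom A y c) (f : hom A x y) :
  is_cokernel p f -> epic p.
Proof.
move=> [pf0 pP] w g h gph.
have [|u [_ uu]] := pP _ (g ∘ p); first by rewrite -compA pf0 compm0.
by rewrite -(uu g erefl) -(uu h (esym gph)).
Qed.

Lemma kernel_of_cokernel x y z c (f : hom A x y) (g : hom A y z)
  (p : hom A y c) : is_kernel f g -> is_cokernel p f -> is_kernel f p.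
Proof.
move=> [gf0 fP] [pf0 pP]; split=> // w h ph0.
have [v [vp _]] := pP _ _ gf0.
by apply: fP; rewrite -vp -compA ph0 compm0.
Qed.

Lemma cokernel_of_kernel x y w k (f : hom A x y) (g : hom A w x)
  (i : hom A k x) : is_cokernel f g -> is_kernel i f -> is_cokernel f i.
Proof.
move=> [fg0 fP] [fi0 iP]; split=> // z h hi0.
have [v [iv _]] := iP _ _ fg0.
by apply: fP; rewrite -iv compA hi0 comp0m.
Qed.

Lemma monic_kernel0 k x y (i : hom A k x) (f : hom A x y) :
  is_kernel i f -> i = 0 -> monic f.
Proof.
move=> [_ iP] i0 w g h fgh; apply/subr0_eq.
have [|u [<- _]] := iP _ (g - h); last by rewrite i0 comp0m.
by rewrite compDr compmN fgh subrr.
Qed.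

Lemma epic_cokernel0 x y c (p : hom A y c) (f : hom A x y) :
  is_cokernel p f -> p = 0 -> epic f.
Proof.
move=> [_ pP] p0 w g h gfh; apply/subr0_eq.
have [|u [<- _]] := pP _ (g - h); last by rewrite p0 compm0.
by rewrite compDl compNm gfh subrr.
Qed.

End PreadditiveTheory.

Record functor (obP obA : Type) (P : category obP) (A : category obA) :=
  Functor {
    fob :> obP -> obA;
    fmap : forall p q, hom P p q -> hom A (fob p) (fob q);
    fmap1 : forall p, fmap (idm p) = idm (fob p);
    fmapM : forall p q r (g : hom P q r) (f : hom P p q),
      fmap (g ∘ f) = fmap g ∘ fmap f }.

Record nattrans (obP obA : Type) (P : category obP) (A : category obA)
    (F G : functor P A) := NatTrans {
  component :> forall p, hom A (F p) (G p);
  naturality : forall p q (f : hom P p q),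
    component q ∘ fmap F f = fmap G f ∘ component p }.

Section FunctorCategory.
Context {obP obA : Type} (P : category obP).

Lemma nattransP (A : category obA) (F G : functor P A)
    (s t : nattrans F G) : (forall p, s p = t p) -> s = t.
Proof.
case: s t => [s sN] [t tN] /= st.
have e : s = t by apply: functional_extensionality_dep.
by case: t / e tN {st} => tN; congr NatTrans; exact: Prop_irrelevance.
Qed.

Section Category.
Context (A : category obA).
Implicit Types F G H : functor P A.

Fact nat_id_subproof F p q (f : hom P p q) :
  idm (F q) ∘ fmap F f = fmap F f ∘ idm (F p).
Proof. by rewrite comp1m compm1. Qed.
Definition nat_id F : nattrans F F := NatTrans (@nat_id_subproof F).

Fact nat_comp_subproof F G H (t : nattrans G H) (s : nattrans F G)
  p q (f : hom P p q) : (t q ∘ s q) ∘ fmap F f = fmap H f ∘ (t p ∘ s p).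
Proof. by rewrite -compA naturality compA naturality compA. Qed.
Definition nat_comp F G H (t : nattrans G H) (s : nattrans F G) :
  nattrans F H := NatTrans (nat_comp_subproof t s).

Fact nat_compA F G H I (u : nattrans H I) (t : nattrans G H)
  (s : nattrans F G) : nat_comp u (nat_comp t s) = nat_comp (nat_comp u t) s.
Proof. by apply: nattransP => p; rewrite /= compA. Qed.
Fact nat_comp1m F G (s : nattrans F G) : nat_comp (nat_id G) s = s.
Proof. by apply: nattransP => p; rewrite /= comp1m. Qed.
Fact nat_compm1 F G (s : nattrans F G) : nat_comp s (nat_id F) = s.
Proof. by apply: nattransP => p; rewrite /= compm1. Qed.

Definition functor_category : category (functor P A) :=
  Category nat_compA nat_comp1m nat_compm1.

End Category.

Section Preadditive.
Context (A : preadditive obA).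
Implicit Types F G H : functor P A.

Fact nat_zero_subproof F G p q (f : hom P p q) :
  (0 : hom A (F q) (G q)) ∘ fmap F f = fmap G f ∘ 0.
Proof. by rewrite comp0m compm0. Qed.
Definition nat_zero F G : nattrans F G :=
  NatTrans (@nat_zero_subproof F G).

Fact nat_opp_subproof F G (s : nattrans F G) p q (f : hom P p q) :
  (- s q) ∘ fmap F f = fmap G f ∘ (- s p).
Proof. by rewrite compNm compmN naturality. Qed.
Definition nat_opp F G (s : nattrans F G) : nattrans F G :=
  NatTrans (nat_opp_subproof s).

Fact nat_add_subproof F G (s t : nattrans F G) p q (f : hom P p q) :
  (s q + t q) ∘ fmap F f = fmap G f ∘ (s p + t p).
Proof. by rewrite compDl compDr !naturality. Qed.
Definition nat_add F G (s t : nattrans F G) : nattrans F G :=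
  NatTrans (nat_add_subproof s t).

Fact nat_addA F G : associative (@nat_add F G).
Proof. by move=> s t u; apply: nattransP => p; exact: addrA. Qed.
Fact nat_addC F G : commutative (@nat_add F G).
Proof. by move=> s t; apply: nattransP => p; exact: addrC. Qed.
Fact nat_add0 F G : left_id (nat_zero F G) (@nat_add F G).
Proof. by move=> s; apply: nattransP => p; exact: add0r. Qed.
Fact nat_addN F G : left_inverse (nat_zero F G) (@nat_opp F G) (@nat_add F G).
Proof. by move=> s; apply: nattransP => p; exact: addNr. Qed.

HB.instance Definition _ F G := gen_eqMixin (nattrans F G).
HB.instance Definition _ F G := gen_choiceMixin (nattrans F G).
HB.instance Definition _ F G := GRing.isZmodule.Build (nattrans F G)
  (@nat_addA F G) (@nat_addC F G) (@nat_add0 F G) (@nat_addN F G).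

Definition functor_homgroup : homgroup_category (functor P A) :=
  @HomgroupCategory _ (functor_category A)
    (fun F G => GRing.Zmodule.on (nattrans F G)).

Fact nat_compDl F G H (t t' : hom functor_homgroup G H)
  (s : hom functor_homgroup F G) : (t + t') ∘ s = t ∘ s + t' ∘ s.
Proof. by apply: nattransP => p; exact: compDl. Qed.
Fact nat_compDr F G H (t : hom functor_homgroup G H)
  (s s' : hom functor_homgroup F G) : t ∘ (s + s') = t ∘ s + t ∘ s'.
Proof. by apply: nattransP => p; exact: compDr. Qed.

Definition functor_preadditive : preadditive (functor P A) :=
  Preadditive nat_compDl nat_compDr.

Lemma pointwise_kernel K F G (i : hom functor_preadditive K F)
    (s : hom functor_preadditive F G) :
  (forall p, is_kernel (i p) (s p)) -> is_kernel i s.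
Proof.
move=> isP; split=> [|H h sh0].
  by apply: nattransP => p; case: (isP p).
have shp0 p : s p ∘ h p = 0.
  by rewrite -[s p ∘ h p]/((s ∘ h : nattrans _ _) p) sh0.
pose u p := projT1 (cid ((isP p).2 _ _ (shp0 p))).
have iu p : i p ∘ u p = h p by rewrite /u; case: cid => v [].
have uN p q (f : hom P p q) : u q ∘ fmap H f = fmap K f ∘ u p.
  apply: (kernel_monic (isP q)).
  by rewrite compA iu naturality compA naturality -compA iu.
exists (NatTrans uN); split=> [|v iv]; apply: nattransP => p /=.
  exact: iu.
by apply: (kernel_monic (isP p)); rewrite iu -iv.
Qed.

Lemma pointwise_cokernel F G C (c : hom functor_preadditive G C)
    (s : hom functor_preadditive F G) :
  (forall p, is_cokernel (c p) (s p)) -> is_cokernel c s.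
Proof.
move=> csP; split=> [|H h hs0].
  by apply: nattransP => p; case: (csP p).
have hsp0 p : h p ∘ s p = 0.
  by rewrite -[h p ∘ s p]/((h ∘ s : nattrans _ _) p) hs0.
pose u p := projT1 (cid ((csP p).2 _ _ (hsp0 p))).
have uc p : u p ∘ c p = h p by rewrite /u; case: cid => v [].
have uN p q (f : hom P p q) : u q ∘ fmap C f = fmap H f ∘ u p.
  apply: (cokernel_epic (csP p)).
  by rewrite -!compA uc -naturality compA uc naturality.
exists (NatTrans uN); split=> [|v vc]; apply: nattransP => p /=.
  exact: uc.
by apply: (cokernel_epic (csP p)); rewrite uc -vc.
Qed.

End Preadditive.

Section Abelian.
Context (A : abelian_category obA).
Implicit Types F G H : functor P A.
Local Notation AP := (functor_preadditive A).

Lemma exists_pointwise_kernel F G (s : hom AP F G) :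
  exists K (i : hom AP K F), forall p, is_kernel (i p) (s p).
Proof.
pose K p := projT1 (cid (ab_kernel (s p))).
pose i p : hom A (K p) (F p) := projT1 (cid (projT2 (cid (ab_kernel (s p))))).
have iP p : is_kernel (i p) (s p).
  exact: projT2 (cid (projT2 (cid (ab_kernel (s p))))).
have H p q (f : hom P p q) : s q ∘ (fmap F f ∘ i p) = 0.
  by rewrite compA naturality -compA (iP p).1 compm0.
pose m p q (f : hom P p q) := projT1 (cid ((iP q).2 _ _ (H p q f))).
have mP p q (f : hom P p q) : i q ∘ m p q f = fmap F f ∘ i p.
  by rewrite /m; case: cid => v [].
have m1 p : m p p (idm p) = idm (K p).
  by apply: (kernel_monic (iP p)); rewrite mP fmap1 comp1m compm1.
have mM p q r (g : hom P q r) (f : hom P p q) :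
    m p r (g ∘ f) = m q r g ∘ m p q f.
  apply: (kernel_monic (iP r)).
  by rewrite mP compA mP -compA mP compA fmapM.
by exists (Functor m1 mM), (NatTrans (F := Functor m1 mM) (G := F) mP).
Qed.

Lemma exists_pointwise_cokernel F G (s : hom AP F G) :
  exists C (c : hom AP G C), forall p, is_cokernel (c p) (s p).
Proof.
pose C p := projT1 (cid (ab_cokernel (s p))).
pose c p : hom A (G p) (C p) :=
  projT1 (cid (projT2 (cid (ab_cokernel (s p))))).
have cP p : is_cokernel (c p) (s p).
  exact: projT2 (cid (projT2 (cid (ab_cokernel (s p))))).
have H p q (f : hom P p q) : (c q ∘ fmap G f) ∘ s p = 0.
  by rewrite -compA -naturality compA (cP q).1 comp0m.
pose m p q (f : hom P p q) := projT1 (cid ((cP p).2 _ _ (H p q f))).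
have mP p q (f : hom P p q) : m p q f ∘ c p = c q ∘ fmap G f.
  by rewrite /m; case: cid => v [].
have m1 p : m p p (idm p) = idm (C p).
  by apply: (cokernel_epic (cP p)); rewrite mP fmap1 comp1m compm1.
have mM p q r (g : hom P q r) (f : hom P p q) :
    m p r (g ∘ f) = m q r g ∘ m p q f.
  apply: (cokernel_epic (cP p)).
  by rewrite mP -compA mP compA mP -compA fmapM.
have mN p q (f : hom P p q) : c q ∘ fmap G f = m p q f ∘ c p by [].
by exists (Functor m1 mM), (NatTrans (F := G) (G := Functor m1 mM) mN).
Qed.

Lemma monic_pointwise F G (s : hom AP F G) :
  monic s -> forall p, monic (s p).
Proof.
move=> sm p; have [K [i iP]] := exists_pointwise_kernel s.
apply: (monic_kernel0 (iP p)).
suff -> : i = 0 by [].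
by apply: sm; rewrite (pointwise_kernel iP).1 compm0.
Qed.

Lemma epic_pointwise F G (s : hom AP F G) :
  epic s -> forall p, epic (s p).
Proof.
move=> se p; have [C [c cP]] := exists_pointwise_cokernel s.
apply: (epic_cokernel0 (cP p)).
suff -> : c = 0 by [].
by apply: se; rewrite (pointwise_cokernel cP).1 comp0m.
Qed.

Fact functor_zero : exists Z, is_zero AP Z.
Proof.
have [z [z1 z2]] := ab_zero A.
pose m p q (f : hom P p q) : hom A z z := idm z.
have m1 p : m p p (idm p) = idm z by [].
have mM p q r (g : hom P q r) (f : hom P p q) :
  m p r (g ∘ f) = m q r g ∘ m p q f by rewrite /m comp1m.
exists (Functor (fob := fun=> z) m1 mM); split=> F; exists 0 => s;
  apply: nattransP => p /=.
  by have [t tP] := z1 (F p); rewrite (tP (s p)) [RHS]tP.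
by have [t tP] := z2 (F p); rewrite (tP (s p)) [RHS]tP.
Qed.

Fact functor_biproduct F G : exists B
  (i : hom AP F B) (j : hom AP G B) (r : hom AP B F) (s : hom AP B G),
  is_biproduct i j r s.
Proof.
have /cid[B /cid[i /cid[j /cid[r /cid[s bP]]]]] :
    exists (B : obP -> obA) (i : forall p, hom A (F p) (B p))
      (j : forall p, hom A (G p) (B p)) (r : forall p, hom A (B p) (F p))
      (s : forall p, hom A (B p) (G p)),
      forall p, is_biproduct (i p) (j p) (r p) (s p).
  pose b p := cid (ab_biproduct A (F p) (G p)).
  pose i p := cid (projT2 (b p)).
  pose j p := cid (projT2 (i p)).
  pose r p := cid (projT2 (j p)).
  pose s p := cid (projT2 (r p)).
  exists (fun p => projT1 (b p)), (fun p => projT1 (i p)),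
    (fun p => projT1 (j p)), (fun p => projT1 (r p)), (fun p => projT1 (s p)).
  by move=> p; exact: projT2 (s p).
pose m p q (f : hom P p q) : hom A (B p) (B q) :=
  i q ∘ fmap F f ∘ r p + j q ∘ fmap G f ∘ s p.
have mi p q f : m p q f ∘ i p = i q ∘ fmap F f.
  have [ri _ si _ _] := bP p.
  by rewrite /m compDl -!compA ri si !compm0 addr0 compm1.
have mj p q f : m p q f ∘ j p = j q ∘ fmap G f.
  have [_ sj _ rj _] := bP p.
  by rewrite /m compDl -!compA rj sj !compm0 add0r compm1.
have rm p q f : r q ∘ m p q f = fmap F f ∘ r p.
  have [ri _ _ rj _] := bP q.
  by rewrite /m compDr !compA ri rj !comp0m addr0 comp1m.
have sm p q f : s q ∘ m p q f = fmap G f ∘ s p.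
  have [_ sj si _ _] := bP q.
  by rewrite /m compDr !compA si sj !comp0m add0r comp1m.
have m1 p : m p p (idm p) = idm (B p).
  by have [_ _ _ _ <-] := bP p; rewrite /m !fmap1 !compm1.
have mM p q t (g : hom P q t) (f : hom P p q) :
    m p t (g ∘ f) = m q t g ∘ m p q f.
  rewrite {2}/m compDl -[i t ∘ _ ∘ _ ∘ _]compA -[j t ∘ _ ∘ _ ∘ _]compA rm sm.
  by rewrite /m !fmapM !compA.
pose BF : functor P A := Functor m1 mM.
have iN p q f : i q ∘ fmap F f = fmap BF f ∘ i p by rewrite /= mi.
have jN p q f : j q ∘ fmap G f = fmap BF f ∘ j p by rewrite /= mj.
exists BF, (NatTrans (F := F) (G := BF) iN), (NatTrans (F := G) (G := BF) jN),
  (NatTrans (F := BF) (G := F) rm), (NatTrans (F := BF) (G := G) sm).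
by split; apply: nattransP => p; case: (bP p).
Qed.

Fact functor_kernel F G (s : hom AP F G) :
  exists K (i : hom AP K F), is_kernel i s.
Proof.
have [K [i iP]] := exists_pointwise_kernel s.
by exists K, i; exact: pointwise_kernel.
Qed.

Fact functor_cokernel F G (s : hom AP F G) :
  exists C (c : hom AP G C), is_cokernel c s.
Proof.
have [C [c cP]] := exists_pointwise_cokernel s.
by exists C, c; exact: pointwise_cokernel.
Qed.

Fact functor_monic F G (s : hom AP F G) :
  monic s -> exists H (t : hom AP G H), is_kernel s t.
Proof.
move=> /monic_pointwise sm; have [C [c cP]] := exists_pointwise_cokernel s.
exists C, c; apply: pointwise_kernel => p.
have [z [g gP]] := ab_monic (sm p).
exact: kernel_of_cokernel gP (cP p).
Qed.

Fact functor_epic F G (s : hom AP F G) :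
  epic s -> exists H (t : hom AP H F), is_cokernel s t.
Proof.
move=> /epic_pointwise se; have [K [i iP]] := exists_pointwise_kernel s.
exists K, i; apply: pointwise_cokernel => p.
have [z [g gP]] := ab_epic (se p).
exact: cokernel_of_kernel gP (iP p).
Qed.

Definition functor_abelian : abelian_category (functor P A) :=
  AbelianCategory functor_zero functor_biproduct functor_kernel
    functor_cokernel functor_monic functor_epic.

End Abelian.
End FunctorCategory.

Section Amplitudes.
Context {R : realType} {ob : Type} (A : abelian_category ob).
Implicit Types (O : set ob) (alpha : ob -> \bar R).

Definition object_class O : Prop :=
  (forall z, is_zero A z -> O z) /\
  (forall x y, isomorphic A x y -> O x -> O y).

(* Only the values of alpha on O are constrained. *)
Definition weight O alpha : Prop :=
  [/\ forall x, O x -> (0 <= alpha x)%E,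
      forall z, is_zero A z -> alpha z = 0%E
    & forall x y, O x -> O y -> isomorphic A x y -> alpha x = alpha y].

Definition amplitude O alpha : Prop :=
  [/\ object_class O, weight O alpha
    & forall x y z (f : hom A x y) (g : hom A y z), short_exact f g ->
      [/\ O x -> O y -> (alpha x <= alpha y)%E,
          O y -> O z -> (alpha z <= alpha y)%E
        & O x -> O y -> O z -> (alpha y <= alpha x + alpha z)%E]].

End Amplitudes.

Section IntegralAmplitude.
(* measurableType extends pointedType, so P has at least one object; over the
   empty category every integral is 0. *)
Context {d : measure_display} {P : measurableType d} {R : realType}.
Context {obA : Type} (cP : category P) (A : abelian_category obA).
Context (O : set obA) (mu : {measure set P -> \bar R}).
Context (alpha : obA -> \bar R).

Definition integrable_modules : set (functor cP A) :=
  [set M | (forall p, O (M p)) /\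
           mu.-integrable [set: P] (fun p => alpha (M p))].

Definition integral_weight (M : functor cP A) : \bar R :=
  (\int[mu]_p alpha (M p))%E.

End IntegralAmplitude.

(* Main.v *)
(** Kernels and cokernels in [functor_abelian cP A] are computed objectwise, so a
    short exact sequence of persistence modules is short exact at every object
    of [P].  The amplitude axioms for [alpha] therefore hold pointwise for the
    functions [p |-> alpha (M p)], and they are preserved by integration since
    the integral is monotone and additive. *)
Require Import Defs.
From mathcomp Require Import all_boot all_order all_algebra.
From mathcomp Require Import all_classical all_reals all_analysis.

Local Open Scope classical_set_scope.
Local Open Scope ring_scope.

Section PreadditiveTheory.
Local Notation hom := Defs.hom.
Context {ob : Type} {A : preadditive ob}.

(** Composing with [v] turns factorizations through [i] into factorizations through [i ∘ u], and
    composing with [u] turns them back, so existence and uniqueness both carry over. *)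
Lemma kernel_iso {k k' x y : ob} {i : hom A k x} {f : hom A x y}
    {u : hom A k' k} {v : hom A k k'} :
  is_kernel i f -> v ∘ u = idm k' -> u ∘ v = idm k -> is_kernel (i ∘ u) f.
Proof.
move=> [fi0 iP] vu uv; split=> [|w g fg0]; first by rewrite Defs.compA fi0 Defs.comp0m.
have [h [ih hP]] := iP w g fg0.
exists (v ∘ h); split=> [|h' iuh'].
  by rewrite -Defs.compA (Defs.compA u) uv comp1m.
by rewrite (hP (u ∘ h')) ?Defs.compA // vu comp1m.
Qed.

Lemma cokernel_iso {x y c c' : ob} {p : hom A y c} {f : hom A x y}
    {u : hom A c c'} {v : hom A c' c} :
  is_cokernel p f -> v ∘ u = idm c -> u ∘ v = idm c' -> is_cokernel (u ∘ p) f.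
Proof.
move=> [pf0 pP] vu uv; split=> [|w g gf0]; first by rewrite -Defs.compA pf0 compm0.
have [h [hp hP]] := pP w g gf0.
exists (h ∘ v); split=> [|h' h'up].
  by rewrite Defs.compA -(Defs.compA h) vu compm1.
by rewrite (hP (h' ∘ u)) -?Defs.compA // uv compm1.
Qed.

Lemma kernel_unique {k k' x y : ob} {i : hom A k x} {i' : hom A k' x}
    {f : hom A x y} : is_kernel i f -> is_kernel i' f ->
  exists (u : hom A k' k) (v : hom A k k'),
    [/\ v ∘ u = idm k', u ∘ v = idm k & i ∘ u = i'].
Proof.
move=> iP i'P.
have [u [iu _]] := iP.2 _ _ i'P.1.
have [v [i'v _]] := i'P.2 _ _ iP.1.
exists u, v; split=> //.
  by apply: (kernel_monic i'P); rewrite Defs.compA i'v iu compm1.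
by apply: (kernel_monic iP); rewrite Defs.compA iu i'v compm1.
Qed.

Lemma cokernel_unique {x y c c' : ob} {p : hom A y c} {p' : hom A y c'}
    {f : hom A x y} : is_cokernel p f -> is_cokernel p' f ->
  exists (u : hom A c c') (v : hom A c' c),
    [/\ v ∘ u = idm c, u ∘ v = idm c' & u ∘ p = p'].
Proof.
move=> pP p'P.
have [u [up _]] := pP.2 _ _ p'P.1.
have [v [vp' _]] := p'P.2 _ _ pP.1.
exists u, v; split=> //.
  by apply: (cokernel_epic pP); rewrite -Defs.compA up vp' comp1m.
by apply: (cokernel_epic p'P); rewrite -Defs.compA vp' up comp1m.
Qed.

(** Every morphism into or out of [z] factors through [idm z]. This reduces being a zero object to a
    single equation between morphisms. *)
Lemma is_zero_idm {z : ob} : idm z = 0 :> hom A z z -> is_zero A z.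
Proof.
move=> z0; split=> x; exists 0 => g.
  by rewrite -[g]compm1 z0 compm0.
by rewrite -[g]comp1m z0 Defs.comp0m.
Qed.

End PreadditiveTheory.

Section FunctorExactness.
Local Notation hom := Defs.hom.
Context {obP obA : Type} {P : category obP} {A : abelian_category obA}.
Local Notation AP := (functor_abelian P A).

(** The kernel built objectwise is a kernel in [AP], so any other kernel differs from it by an
    isomorphism, whose components are isomorphisms in [A]. *)
Lemma kernel_pointwise {K F G : functor P A} {i : hom AP K F} {s : hom AP F G} :
  is_kernel i s -> forall p, is_kernel (i p) (s p).
Proof.
move=> iP p; have [K' [i' i'P]] := exists_pointwise_kernel s.
have [u [v [vu uv <-]]] := kernel_unique (pointwise_kernel i'P) iP.
apply: (kernel_iso (i'P p) (v := v p)).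
  (* An equation between natural transformations is evaluated at [p]. *)
  exact (congr1 (fun t : nattrans K K => t p) vu).
exact (congr1 (fun t : nattrans K' K' => t p) uv).
Qed.

Lemma cokernel_pointwise {F G C : functor P A} {c : hom AP G C}
    {s : hom AP F G} : is_cokernel c s -> forall p, is_cokernel (c p) (s p).
Proof.
move=> cP p; have [C' [c' c'P]] := exists_pointwise_cokernel s.
have [u [v [vu uv <-]]] := cokernel_unique (pointwise_cokernel c'P) cP.
apply: (cokernel_iso (c'P p) (v := v p)).
  exact (congr1 (fun t : nattrans C' C' => t p) vu).
exact (congr1 (fun t : nattrans C C => t p) uv).
Qed.

(** An image is a kernel of a cokernel, so the components at [p] of the functors and transformations
    witnessing exactness in [AP] witness it in [A]. *)
Lemma short_exact_pointwise {F G H : functor P A} {f : hom AP F G}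
    {g : hom AP G H} :
  short_exact f g -> forall p, short_exact (A := A) (f p) (g p).
Proof.
move=> [fm [K [i [[C [c [cP icP]]] igP]]] ge] p; split.
- exact: monic_pointwise fm p.
- exists (K p), (i p); split; last exact: kernel_pointwise igP p.
  exists (C p), (c p); split; first exact: cokernel_pointwise cP p.
  exact: kernel_pointwise icP p.
- exact: epic_pointwise ge p.
Qed.

(** [is_zero AP Z] speaks of morphisms between functors only; its consequence [idm Z = 0] is an
    equation that can be evaluated at [p]. *)
Lemma is_zero_pointwise {Z : functor P A} :
  is_zero AP Z -> forall p, is_zero A (Z p).
Proof.
move=> [Z0 _] p; have [s sP] := Z0 Z; apply: is_zero_idm.
have idZ : idm Z = 0 :> hom AP Z Z by rewrite (sP (idm Z)) [RHS]sP.
exact (congr1 (fun t : nattrans Z Z => t p) idZ).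
Qed.

Lemma isomorphic_pointwise {F G : functor P A} :
  isomorphic AP F G -> forall p, isomorphic A (F p) (G p).
Proof.
move=> [f [g [gf fg]]] p; exists (f p), (g p); split.
  exact (congr1 (fun t : nattrans F F => t p) gf).
exact (congr1 (fun t : nattrans G G => t p) fg).
Qed.

End FunctorExactness.

Theorem lemma4p3 (R : realType) (d : measure_display) (P : measurableType d)
    (cP : category P) (mu : {measure set P -> \bar R})
    (obA : Type) (A : abelian_category obA)
    (O : set obA) (alpha : obA -> \bar R)
    (O_class : object_class A O) (alpha_weight : weight A O alpha) :
  amplitude A O alpha ->
  amplitude (functor_abelian cP A) (integrable_modules O mu alpha)
    (integral_weight mu alpha).
Proof.
case: O_class => O0 Oiso; case: alpha_weight => a_ge0 a0 aiso [_ _ ampl].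
(* Stated as equalities of functions, this and [alpha_iso] can be rewritten both in the
   integrability condition and under the integral. *)
have alpha_zero Z : is_zero (functor_abelian cP A) Z ->
    (fun p => alpha (Z p)) = cst 0%E.
  by move=> Z0; apply/funext => p; exact/a0/is_zero_pointwise.
have alpha_iso (F G : functor cP A) : isomorphic (functor_abelian cP A) F G ->
    (forall p, O (F p)) -> (forall p, O (G p)) ->
    (fun p => alpha (F p)) = (fun p => alpha (G p)).
  move=> FG OF OG; apply/funext => p.
  exact/aiso/isomorphic_pointwise.
split.
- split=> [Z Z0|F G FG [OF iF]].
    split=> [p|]; first exact/O0/is_zero_pointwise.
    (* The zero function is integrable even when [mu] is infinite. *)
    by rewrite (alpha_zero Z Z0); exact: integrable0.
  have OG p : O (G p) by exact: Oiso (isomorphic_pointwise FG p) (OF p).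
  by split=> //; rewrite -(alpha_iso F G).
- split=> [F [OF _]|Z Z0|F G [OF _] [OG _] FG].
  + by apply: integral_ge0 => p _; exact: a_ge0.
  + by rewrite /integral_weight (alpha_zero Z Z0) integral0.
  + by rewrite /integral_weight (alpha_iso F G).
- move=> F G H f g /short_exact_pointwise fg; rewrite /integral_weight.
  split=> [[OF iF] [OG iG]|[OG iG] [OH iH]|[OF iF] [OG iG] [OH iH]].
  + apply: le_integral => // p _.
    by have [+ _ _] := ampl _ _ _ _ _ (fg p); exact.
  + apply: le_integral => // p _.
    by have [_ + _] := ampl _ _ _ _ _ (fg p); exact.
  (* Additivity merges the right-hand side into the integral of one function, integrable as a sum,
     to which monotonicity applies. *)
  + rewrite -integralD //; apply: le_integral => // [|p _].
      exact: integrableD.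
    by have [_ _ +] := ampl _ _ _ _ _ (fg p); exact.
Qed.
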